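(* (1) Let $L=F_0(x)+F_1(x)R+G_0(x)\partial_x+G_1(x)\partial_xR$ be a first order operator of Dunkl type with real-valued coefficient functions $F_0,F_1,G_0,G_1$ on $\mathbb{R}\setminus\{0\}$. Suppose that for every $n=0,1,2,\dots$ there is a monic polynomial $P_n$ of degree $n$ with $LP_n=\lambda_nP_n$, where $\lambda_0=0$, $\lambda_n\neq 0$ for $n\ge1$, and $\lambda_n\neq\lambda_m$ for $n\neq m$. Suppose also that $L$ is symmetrizable (as defined in the context). Then $G_0=0$ and $F_1=-F_0$, so that $L=F(x)(I-R)+G_1(x)\partial_xR$ with $F=F_0$. Suppose moreover that we are in the generic case in which $$G_1(x)=\frac{g_1(x-d)(x+c')}{x}$$ with real $g_1\neq0$, $d\ne 0$, $c'$ satisfying $0<c'/d<1$. Then, after multiplying $L$ by a nonzero real constant and rescaling the independent variable $x$ by a nonzero real constant, one has $$G_1(x)=\frac{2(x-1)(x+c)}{x},\qquad F(x)=-\frac{c}{x^2}+\frac{\beta-\alpha c}{x}-\alpha-\beta-1$$ with $c=c'/d\in(0,1)$ and some real parameters $\alpha,\beta$. (2) For $0<c<1$, $\alpha>-1$, $\beta>-1$, the operator $L=F(x)(I-R)+G_1(x)\partial_xR$ with $F$ and $G_1$ given by the last two formulas has the big $-1$-Jacobi polynomials with parameters $\alpha,\beta,c$ as eigenfunctions.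
   Context: $R$ is the reflection operator $(Rf)(x)=f(-x)$, $I$ is the identity, $\partial_x$ is differentiation in $x$; products of operators are compositions, the rightmost acting first, so $(\partial_xRf)(x)=\frac{d}{dx}(f(-x))$. The eigenvalue equations are identities of functions on $x\neq0$. Lagrange adjoint: for an operator with real-valued coefficients $M=\sum_{k=0}^NA_k(x)\partial_x^k+\sum_{k=0}^NB_k(x)\partial_x^kR$, the Lagrange adjoint is $$M^*=\sum_{k=0}^N(-1)^k\partial_x^kA_k(x)+\sum_{k=0}^N\partial_x^kB_k(-x)R,$$ where $A_k(x)$, $B_k(-x)$ act as multiplication operators (this uses the formal rules $R\partial_x=-\partial_xR$, $R^*=R$, $RB(x)=B(-x)R$). Symmetrizable: $L$ is called symmetrizable if there exist a nonempty open set $E\subset\mathbb{R}$ that is symmetric under $x\mapsto-x$ (an interval $(-a,a)$ or a union of intervals symmetric under reflection) and a continuously differentiable function $w>0$ on $E\setminus\{0\}$ such that $(w(x)L)^*=w(x)L$ on $E\setminus\{0\}$, as an identity of operators (equality of the coefficients of $I,\partial_x,R,\partial_xR$). Rescaling $x$ by a constant $\kappa\ne0$ means writing $x=\kappa y$ and expressing $L$ as an operator in the variable $y$. Big $-1$-Jacobi polynomials: for $\alpha>-1$, $\beta>-1$, $0<c<1$, these are the monic polynomials $P_n$, $\deg P_n=n$, $n=0,1,2,\dots$, orthogonal on $[-1,-c]\cup[c,1]$ with respect to the positive weight function $$w(x)=\frac{|x|}{x}(x+1)(x-c)(1-x^2)^{(\alpha-1)/2}(x^2-c^2)^{(\beta-1)/2}.$$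 *)

(* Defs.v *)
(* MathComp-Analysis: [R] is an arbitrary [realType]. *)
From HB Require Import structures.
From mathcomp Require Import all_boot all_order all_algebra.
From mathcomp Require Import all_classical all_reals all_analysis.
Set Implicit Arguments.
Unset Strict Implicit.
Unset Printing Implicit Defensive.
Import Order.TTheory GRing.Theory Num.Theory numFieldNormedType.Exports.
Local Open Scope classical_set_scope.
Local Open Scope ring_scope.

(* The formal operator  sum_(k <= N) A_k(x) d^k + sum_(k <= N) B_k(x) d^k R,
   where (R f)(x) = f(-x); [dA L k] is A_k and [dB L k] is B_k.  Coefficients
   are total functions, but they are only ever used at points x != 0. *)
Record dunkl_op (R : realType) (N : nat) := DunklOp {
  dA : 'I_N.+1 -> R -> R;
  dB : 'I_N.+1 -> R -> R }.

(* R acts first: d^k R f is the k-th derivative of the function t |-> f(-t). *)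
Definition dunkl_act (R : realType) (N : nat) (L : dunkl_op R N)
    (f : R -> R) (x : R) : R :=
  \sum_(k < N.+1) dA L k x * derive1n k f x
  + \sum_(k < N.+1) dB L k x * derive1n k (fun t => f (- t)) x.

Definition dunkl_eq_on (R : realType) (N : nat) (S : set R)
    (L M : dunkl_op R N) : Prop :=
  forall x, S x -> forall k : 'I_N.+1, dA L k x = dA M k x /\ dB L k x = dB M k x.

Definition dunkl_mul (R : realType) (N : nat) (w : R -> R)
    (L : dunkl_op R N) : dunkl_op R N :=
  {| dA := fun k x => w x * dA L k x; dB := fun k x => w x * dB L k x |}.

(* The Lagrange adjoint  sum_k (-1)^k d^k A_k(x) + sum_k d^k B_k(-x) R,  brought
   to normal form with the Leibniz rule
     d^k A = sum_(j <= k) 'C(k, j) A^(k - j) d^j.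
   [derive1n] is total, so this is meaningful only where A_k and x |-> B_k(-x)
   are k times differentiable. *)
Definition lagrange_adjoint (R : realType) (N : nat)
    (L : dunkl_op R N) : dunkl_op R N :=
  {| dA := fun j x =>
       \sum_(k < N.+1 | (j <= k)%N)
         (-1) ^+ k * 'C(k, j)%:R * derive1n (k - j) (dA L k) x;
     dB := fun j x =>
       \sum_(k < N.+1 | (j <= k)%N)
         'C(k, j)%:R * derive1n (k - j) (fun t => dB L k (- t)) x |}.

(* The values of w outside E \ 0 are irrelevant, E \ 0 being open.  An L of order
   one with eigenpolynomials of every degree has coefficients that are rational
   with poles only at 0, so the coefficients of w L are then C^1 on E \ 0. *)
Definition symmetrizable (R : realType) (N : nat) (L : dunkl_op R N) : Prop :=
  exists (E : set R) (w : R -> R),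
    [/\ E !=set0, open E, (forall x, E x -> E (- x)),
        (forall x, (E `\ 0) x ->
           [/\ 0 < w x, derivable w x 1 & {for x, continuous (derive1 w)}])
      & dunkl_eq_on (E `\ 0) (lagrange_adjoint (dunkl_mul w L)) (dunkl_mul w L)].

(* Expression of L in the variable y, x = kappa * y: d_x = kappa^-1 d_y, while R
   is unchanged. *)
Definition dunkl_rescale (R : realType) (N : nat) (kappa : R)
    (L : dunkl_op R N) : dunkl_op R N :=
  {| dA := fun k y => dA L k (kappa * y) / kappa ^+ k;
     dB := fun k y => dB L k (kappa * y) / kappa ^+ k |}.

(* F0(x) + F1(x) R + G0(x) d + G1(x) d R *)
Definition dunkl1 (R : realType) (F0 F1 G0 G1 : R -> R) : dunkl_op R 1 :=
  {| dA := fun k => if k == ord0 then F0 else G0;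
     dB := fun k => if k == ord0 then F1 else G1 |}.

(* F(x) (I - R) + G(x) d R *)
Definition dunkl_FG (R : realType) (F G : R -> R) : dunkl_op R 1 :=
  dunkl1 F (fun x => - F x) (fun=> 0) G.

Definition dunkl_eigenpoly (R : realType) (N : nat) (L : dunkl_op R N)
    (lambda : R) (p : {poly R}) : Prop :=
  forall x, x != 0 -> dunkl_act L (horner p) x = lambda * p.[x].

Definition bigm1_G (R : realType) (c x : R) : R :=
  2 * (x - 1) * (x + c) / x.

Definition bigm1_F (R : realType) (alpha beta c x : R) : R :=
  - (c / x ^+ 2) + (beta - alpha * c) / x - alpha - beta - 1.

Definition bigm1_support (R : realType) (c : R) : set R :=
  `[-1, - c]%classic `|` `[c, 1]%classic.

Definition bigm1_weight (R : realType) (alpha beta c x : R) : R :=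
  `|x| / x * (x + 1) * (x - c)
  * (1 - x ^+ 2) `^ ((alpha - 1) / 2) * (x ^+ 2 - c ^+ 2) `^ ((beta - 1) / 2).

(* For alpha, beta > -1 and 0 < c < 1 the integrals converge absolutely: the
   weight is positive in the interior of the support, and its exponents at the
   endpoints exceed -1. *)
Definition bigm1_jacobi (R : realType) (alpha beta c : R)
    (P : nat -> {poly R}) : Prop :=
  (forall n, P n \is monic /\ size (P n) = n.+1) /\
  (forall n m, n != m ->
     (\int[lebesgue_measure]_(x in bigm1_support c)
        ((P n).[x] * (P m).[x] * bigm1_weight alpha beta c x)%:E = 0)%E).

(* Main.v *)
Require Import Defs.
From HB Require Import structures.
From mathcomp Require Import all_boot all_order all_algebra.
From mathcomp Require Import all_classical all_reals all_analysis.
From mathcomp Require Import measurable_realfun ring lra.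
Import Order.TTheory GRing.Theory Num.Theory numFieldNormedType.Exports.
Local Open Scope classical_set_scope.
Local Open Scope ring_scope.

(** Part (1). On polynomials of degree at most 3 the operator [L] is already
determined: [L 1 = 0] gives [F1 = - F0], and since [L x], [L x^2], [L x^3]
are polynomials, [4 x^2 G0 = x L(x^2) + L(x^3) - x^2 L(x)] is one too
([dunkl1_poly_G0]). The coefficient of [d] in [wL = (wL)^*] reads
[w G0 = - w G0] ([symmetrizable_G0]), so this polynomial vanishes on a
nonempty open set, hence identically. In the generic case the eigenvalue
equation in degree one, [2 x F0 - G1 = lambda_1 P_1], expresses [F0] through
[G1] and two free constants, which are renamed [alpha] and [beta] after the
rescaling [x = d y] ([dunkl_FG_generic]).

Part (2). [L] maps polynomials of degree at most [n] to polynomials of degree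
at most [n] ([bigm1_op_poly]) and is symmetric for the inner product
[<f, g> = \int f g w] ([bigm1_op_symmetric]); then [L P_n - lambda P_n], with
[lambda] chosen to lower the degree, is orthogonal to every polynomial of
degree less than [n], itself included, and so is zero
([orthogonal_eigenpoly]).

For the symmetry, reflection turns every integral over [[-1, -c] `|` [c, 1]]
into one over [[c, 1]] against
[v(x) = (1 - x^2)^(p - 1) (x^2 - c^2)^(q - 1)], where
[p = (alpha + 1) / 2 > 0] and [q = (beta + 1) / 2 > 0]
([integral_bigm1_weight]). There the integrand of [<Lf, g> - <f, Lg>] is the
derivative of
[H(x) = 2 (f(x) g(-x) - f(-x) g(x)) (1 - x^2)^p (x^2 - c^2)^q / x], which
vanishes at both endpoints. The weight [v] may be unbounded at [c] and at
[1], so two facts on improper integrals are needed: a nonnegative derivative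
of a continuous function is integrable ([ge0_derive_integrable]), which
bounds [v] by an integrable function, and the fundamental theorem of calculus
holds as soon as the derivative is integrable ([integrable_derive_FTC2]). *)

(** * First order Dunkl operators on polynomials *)

Lemma dunkl_act1_horner {R : realType} (F0 F1 G0 G1 : R -> R) (p : {poly R})
    (x : R) :
  dunkl_act (dunkl1 F0 F1 G0 G1) (horner p) x =
  F0 x * p.[x] + F1 x * p.[- x] + G0 x * p^`().[x] - G1 x * p^`().[- x].
Proof.
have reflE : (fun t : R => p.[- t]) = horner (p \Po (- 'X)).
  by apply/funext => t; rewrite horner_comp !hornerE.
rewrite /dunkl_act !big_ord_recr !big_ord0 /= !add0r reflE -!derivE.
rewrite deriv_comp derivN derivX !(hornerM, hornerN, hornerC).
rewrite !(horner_comp, hornerX, hornerN).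
ring.
Qed.

Lemma dunkl_act_FG_horner {R : realType} (F G : R -> R) (p : {poly R}) (x : R) :
  dunkl_act (dunkl_FG F G) (horner p) x =
  F x * (p.[x] - p.[- x]) - G x * p^`().[- x].
Proof. by rewrite dunkl_act1_horner; ring. Qed.

Lemma poly_eq0_open {R : realType} (p : {poly R}) (E : set R) :
  E !=set0 -> open E -> (forall x, E x -> p.[x] = 0) -> p = 0.
Proof.
move=> [x0 Ex0] oE pE.
have /nbhs_ballP[e /= e0 be] : nbhs x0 E by apply: open_nbhs_nbhs.
apply/eqP/negPn/negP => p0.
(* More distinct zeros than the degree allows. *)
pose rs := [seq x0 + e / k.+2%:R | k <- iota 0 (size p)].
have /(_ p0) : p != 0 -> (size rs < size p)%N.
  move=> _; apply: max_poly_roots p0 _ _.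
    apply/allP => _ /mapP[k _ ->]; apply/rootP/pE/be.
    rewrite /ball /= opprD addNKr normrN gtr0_norm ?divr_gt0 ?ltr0n//.
    by rewrite ltr_pdivrMr ?ltr0n// ltr_pMr// ltr1n.
  rewrite map_inj_uniq ?iota_uniq// => i j /addrI /(mulfI (lt0r_neq0 e0)).
  by move/invr_inj/eqP; rewrite eqr_nat => /eqP[].
by rewrite size_map size_iota ltnn.
Qed.

(** * Symmetrizable operators with polynomial eigenfunctions *)

(** The odd-degree images [L x = 2 x F0 + G0 - G1] and
[L x^3 = 2 x^3 F0 + 3 x^2 (G0 - G1)] determine [G0 - G1], and
[L x^2 = 2 x (G0 + G1)] determines [G0 + G1]. *)
Lemma dunkl1_poly_G0 {R : realType} (F0 F1 G0 G1 : R -> R) (lambda : nat -> R) :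
  (forall n, exists P : {poly R},
     [/\ P \is monic, size P = n.+1
       & dunkl_eigenpoly (dunkl1 F0 F1 G0 G1) (lambda n) P]) ->
  (forall x, x != 0 -> F1 x = - F0 x) ->
  exists q : {poly R}, forall x, x != 0 -> q.[x] = 4 * x ^+ 2 * G0 x.
Proof.
move=> eig F1E.
have [P1 [/monicP m1 s1 e1]] := eig 1%N.
have [P2 [/monicP m2 s2 e2]] := eig 2%N.
have [P3 [/monicP m3 s3 e3]] := eig 3%N.
have c1 : P1`_1 = 1 by rewrite -m1 lead_coefE s1.
have c2 : P2`_2 = 1 by rewrite -m2 lead_coefE s2.
have c3 : P3`_3 = 1 by rewrite -m3 lead_coefE s3.
(* The images of x, x^2 and x^3 under L, by elimination of lower monomials. *)
pose u1 := lambda 1%N *: P1.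
pose u2 := lambda 2%N *: P2 - P2`_1 *: u1.
pose u3 := lambda 3%N *: P3 - P3`_2 *: u2 - P3`_1 *: u1.
(* With u_k = L(x^k): x u2 contributes 2 x^2 (G0 + G1) and u3 - x^2 u1 contributes
   2 x^2 (G0 - G1). *)
exists ('X * u2 + u3 - 'X^2 * u1) => x x0.
have dE (p : {poly R}) n y : size p = n.+1 ->
    p^`().[y] = \sum_(i < n) p`_i.+1 *+ i.+1 * y ^+ i.
  move=> sp; rewrite (@horner_coef_wide _ n).
    by apply: eq_bigr => i _; rewrite coef_deriv.
  by rewrite -ltnS -sp lt_size_deriv // -size_poly_gt0 sp.
have hE (p : {poly R}) n y : size p = n.+1 ->
    p.[y] = \sum_(i < n.+1) p`_i * y ^+ i.
  by move=> sp; rewrite horner_coef sp.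
have u1E : u1.[x] = dunkl_act (dunkl1 F0 F1 G0 G1) (horner P1) x.
  by rewrite hornerZ -e1.
have u2E : u2.[x] = dunkl_act (dunkl1 F0 F1 G0 G1) (horner P2) x - P2`_1 * u1.[x].
  by rewrite hornerD hornerN !hornerZ -e2.
have u3E : u3.[x] = dunkl_act (dunkl1 F0 F1 G0 G1) (horner P3) x
    - P3`_2 * u2.[x] - P3`_1 * u1.[x].
  by rewrite hornerD hornerN hornerD hornerN !hornerZ -e3.
clearbody u3; clearbody u2; clearbody u1.
rewrite !(hornerD, hornerN, hornerM, hornerX, hornerXn) u3E u2E u1E.
rewrite !dunkl_act1_horner F1E//.
rewrite !(dE _ _ _ s1) !(dE _ _ _ s2) !(dE _ _ _ s3).
rewrite !(hE _ _ _ s1) !(hE _ _ _ s2) !(hE _ _ _ s3).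
rewrite !big_ord_recr !big_ord0 /= c1 c2 c3.
ring.
Qed.

(** The adjoint changes the sign of the coefficient of [d], the only term of
top order that does not involve [R]. *)
Lemma symmetrizable_G0 {R : realType} (F0 F1 G0 G1 : R -> R) :
  symmetrizable (dunkl1 F0 F1 G0 G1) ->
  exists E : set R, [/\ E !=set0, open E & forall x, E x -> x != 0 -> G0 x = 0].
Proof.
move=> [E [w [E0 oE _ wP adj]]]; exists E; split => // x Ex x0.
have Ex' : (E `\ 0) x by split => //; exact/eqP.
have [w0 _ _] := wP x Ex'.
have [+ _] := adj x Ex' ord_max.
rewrite /= (bigD1 ord_max)//= big1 => [|[[|[|k]] lk]]//=.
rewrite addr0 expr1 /= => /eqP.
rewrite mulr1 mulN1r eq_sym -subr_eq0 opprK -mulr2n mulrn_eq0 /=.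
by rewrite mulf_eq0 gt_eqF//= => /eqP.
Qed.

(** A polynomial identity on the set [E] of the symmetrizability condition,
however small [E] is, extends to the whole line; this is what makes a local
condition conclude globally. *)
Lemma dunkl1_symmetrizable_form {R : realType} (F0 F1 G0 G1 : R -> R)
    (lambda : nat -> R) :
  (forall n, exists P : {poly R},
     [/\ P \is monic, size P = n.+1
       & dunkl_eigenpoly (dunkl1 F0 F1 G0 G1) (lambda n) P]) ->
  lambda 0%N = 0 ->
  symmetrizable (dunkl1 F0 F1 G0 G1) ->
  forall x, x != 0 -> G0 x = 0 /\ F1 x = - F0 x.
Proof.
move=> eig l0 sym.
have F1E x : x != 0 -> F1 x = - F0 x.
  move=> x0; have [P [/monicP mP sP eP]] := eig 0%N.
  move: mP (eP x x0); rewrite lead_coefE sP /= => c1.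
  have -> : P = 1%:P by rewrite -c1; apply: size1_polyC; rewrite sP.
  rewrite dunkl_act1_horner l0 derivC !hornerE => /eqP.
  by rewrite subr0 addrC addr_eq0 => /eqP.
have [q qE] := @dunkl1_poly_G0 R F0 F1 G0 G1 lambda eig F1E.
have [E [E0 oE G0E]] := @symmetrizable_G0 R F0 F1 G0 G1 sym.
have /eqP : 'X * q = 0.
  apply: (@poly_eq0_open R _ E) => // x Ex; rewrite hornerM hornerX.
  have [->|x0] := eqVneq x 0; first by rewrite mul0r.
  by rewrite qE// G0E// !mulr0.
rewrite mulf_eq0 polyX_eq0 /= => /eqP q0 x x0; split; last exact: F1E.
have := qE x x0; rewrite q0 horner0 => /esym/eqP.
by rewrite !mulf_eq0 pnatr_eq0 (negPf x0)/= => /eqP.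
Qed.

(** The eigenvalue equation in degree one leaves two degrees of freedom in
[F0], its [1/y] and constant coefficients; the [1/y^2] coefficient is forced
by [G1]. Matching them with [beta - alpha c] and [- alpha - beta - 1] is a
linear system of determinant [1 + c], nonzero as [c > 0]. *)
Lemma dunkl_FG_generic {R : realType} (F0 G1 : R -> R) (lambda b g1 d c' : R) :
  g1 != 0 -> d != 0 -> 0 < c' / d < 1 ->
  (forall x, x != 0 -> G1 x = g1 * (x - d) * (x + c') / x) ->
  (forall x, x != 0 -> F0 x * (2 * x) - G1 x = lambda * (x + b)) ->
  exists alpha beta : R, forall y, y != 0 ->
    2 / g1 * F0 (d * y) = bigm1_F alpha beta (c' / d) y /\
    2 / g1 * G1 (d * y) / d = bigm1_G (c' / d) y.
Proof.
move=> g0 d0 /andP[c0 c1] GE FE.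
set c := c' / d; pose B := lambda * b / (g1 * d) + c - 1.
pose s := - 2 - lambda / g1.
(* The solution of beta - alpha c = B and alpha + beta = s. *)
exists ((s - B) / (1 + c)), ((s * c + B) / (1 + c)) => y y0.
have c'E : c' = c * d by rewrite mulfVK.
have c10 : 1 + c != 0 by rewrite lt0r_neq0// addr_gt0.
have dy0 : d * y != 0 by rewrite mulf_neq0.
have F0E : F0 (d * y) = (lambda * (d * y + b) + G1 (d * y)) / (2 * (d * y)).
  by rewrite -FE// subrK mulfK// mulf_neq0.
rewrite F0E GE// c'E /bigm1_F /bigm1_G /B /s.
by split; field; rewrite ?y0 ?d0 ?g0 ?c10.
Qed.

(** * Integrals of derivatives that are unbounded at the endpoints *)

Lemma continuous_oo_measurable {R : realType} (f : R -> R) (a b : R) :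
  {in `]a, b[, continuous f} -> measurable_fun `[a, b] f.
Proof.
move=> /in_continuous_mksetP cf.
apply/measurable_fun_itv_bndo_bndcP/measurable_fun_itv_obnd_cbndP.
by apply: open_continuous_measurable_fun => //; exact: interval_open.
Qed.

(** By monotone convergence along compact subintervals exhausting [`]a, b[]:
on each of them the integral of [f] is an increment of [F], at most
[F b - F a]. *)
Lemma ge0_derive_integrable {R : realType} (f F : R -> R) (a b : R) :
  a < b -> {in `]a, b[, continuous f} -> {in `]a, b[, forall x, 0 <= f x} ->
  derivable_oo_LRcontinuous F a b -> {in `]a, b[, F^`()%classic =1 f} ->
  (@lebesgue_measure R).-integrable `[a, b] (EFin \o f).
Proof.
move=> ab cf f0 dF F'f.
have mf : measurable_fun `[a, b] f by exact: continuous_oo_measurable.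
have oocc : `]a, b[%classic `<=` `[a, b]%classic by exact: subset_itv_oo_cc.
have moo : measurable_fun `]a, b[ (EFin \o f).
  by apply/measurable_EFinP; apply: measurable_funS oocc mf.
apply/integrableP; split; first exact/measurable_EFinP.
rewrite integral_itv_bndoo; last by apply: measurableT_comp.
have -> : (\int[lebesgue_measure]_(x in `]a, b[) `|(EFin \o f) x| =
    \int[lebesgue_measure]_(x in `]a, b[) (EFin \o f) x)%E.
  by apply: eq_integral => x; rewrite inE => /f0 f0x; rewrite /= ger0_norm.
have cF : {within `[a, b], continuous F}.
  exact: derivable_oo_LRcontinuous_within.
(* The offset 3 keeps [a + d n, b - d n] nondegenerate from n = 0 on. *)
pose d n : R := (b - a) / (n + 3)%:R.
have d0 n : 0 < d n by rewrite divr_gt0 ?subr_gt0// ltr0n addn3.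
have d3 n : d n * 3 <= b - a.
  rewrite /d mulrAC ler_pdivrMr ?ltr0n ?addn3//.
  by rewrite ler_pM2l ?subr_gt0// ler_nat.
pose A n := `[a + d n, b - d n]%classic.
have Aoo n : A n `<=` `]a, b[%classic.
  move=> x; rewrite /A /= !in_itv/= => /andP[ax xb]; have d0n := d0 n.
  by apply/andP; split; lra.
have ndA : nondecreasing_seq A.
  move=> m n mn; apply/subsetPset => x; rewrite /A /= !in_itv/= => /andP[ax xb].
  have : d n <= d m.
    rewrite /d ler_pM2l ?subr_gt0// lef_pV2 ?posrE ?ltr0n ?addn3//.
    by rewrite ler_nat.
  by move=> ?; apply/andP; split; lra.
have UA : `]a, b[%classic = \bigcup_n A n.
  rewrite eqEsubset; split; last by move=> x [n _]; exact: Aoo.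
  move=> x; rewrite /= in_itv/= => /andP[ax xb].
  pose e := Num.min (x - a) (b - x).
  have e0 : 0 < e by rewrite lt_min !subr_gt0 ax xb.
  pose n := Num.trunc ((b - a) / e); exists n => //.
  have : d n <= e.
    rewrite /d ler_pdivrMr ?ltr0n ?addn3// mulrC -ler_pdivrMr//.
    by rewrite ltW// (lt_le_trans (truncnS_gt _))// ler_nat ltnS leqW.
  rewrite le_min => /andP[? ?]; rewrite /A /= in_itv/=.
  by apply/andP; split; lra.
have IA n : (\int[lebesgue_measure]_(x in A n) (f x)%:E <= (F b - F a)%:E)%E.
  have d0n := d0 n; have d3n := d3 n.
  have anbn : a + d n < b - d n by lra.
  have sub : `[a + d n, b - d n] `<=` `[a, b].
    by apply: subset_trans oocc; exact: Aoo.
  rewrite (@continuous_FTC2 _ f F)//.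
  - rewrite -EFinB lee_fin.
    have ndF : {in `[a, b] &, {homo F : x y / x <= y}}.
      apply: ger0_derive1_le_cc cF => [x|x xab]; first by case: dF => + _ _; apply.
      by rewrite F'f// f0.
    apply: lerB; apply: ndF; rewrite ?in_itv/= ?lexx ?ltW//=; lra.
  - apply/continuous_in_subspaceT => x; rewrite inE => /Aoo xab; exact: cf.
  - exact: derivable_oo_continuousW dF.
  - by move=> x /subset_itv_oo_cc xab; apply: F'f; exact: Aoo xab.
have := @ge0_nondecreasing_set_cvg_integral _ (measurableTypeR R) R A
  (EFin \o f) lebesgue_measure ndA.
rewrite -UA => cvgA.
apply: (@le_lt_trans _ _ (F b - F a)%:E); last exact: ltry.
apply: cvge_le (cvgA _ _ _).
- exact: nearW IA.
- by move=> n; rewrite /A.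
- by move=> n; apply: measurable_funS (Aoo n) moo; rewrite /=.
- by move=> n x /Aoo /f0; rewrite lee_fin.
Qed.

(** The indefinite integral of [f] is continuous on [`[a, b]] by mere
integrability and has derivative [f] inside, so it differs from [F] by a
constant. *)
Lemma integrable_derive_FTC2 {R : realType} (f F : R -> R) (a b : R) :
  a < b -> {in `]a, b[, continuous f} ->
  (@lebesgue_measure R).-integrable `[a, b] (EFin \o f) ->
  derivable_oo_LRcontinuous F a b -> {in `]a, b[, F^`()%classic =1 f} ->
  \int[lebesgue_measure]_(x in `[a, b]) f x = F b - F a.
Proof.
move=> ab cf intf dF F'f.
pose G x := \int[lebesgue_measure]_(t in `[a, x]) f t.
have cF : {within `[a, b], continuous F}.
  exact: derivable_oo_LRcontinuous_within.
have cG : {within `[a, b], continuous G}.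
  by apply: parameterized_integral_continuous => //; exact: ltW.
have dG x : x \in `]a, b[ -> derivable G x 1 /\ G^`()%classic x = f x.
  move=> xab; have := xab; rewrite in_itv/= => /andP[ax xb].
  by apply: (continuous_FTC1_closed xb intf ax); exact: cf.
have [x xab|x xab|//] := @MVT_segment R (F \- G) (cst 0) a b (ltW ab).
- have [dGx G'x] := dG x xab; have [dFo _ _] := dF.
  have dFx : derivable F x 1 := dFo x xab.
  apply: DeriveDef; first exact: derivableB dFx dGx.
  by rewrite (deriveB dFx dGx) -!derive1E G'x F'f// subrr.
- by apply: continuousB; [exact: cF|exact: cG].
move=> z _ /=; rewrite mul0r => /eqP; rewrite subr_eq0 => /eqP.
rewrite /G set_itv1 Rintegral_set1 subr0 => /eqP.
by rewrite subr_eq => /eqP ->; rewrite addrAC subrr add0r.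
Qed.

(** * The weight on the positive half of the support *)

Lemma is_derive_powR_comp {R : realType} (g : R -> R) (dg p x : R) :
  is_derive x 1 g dg -> 0 < g x ->
  is_derive x 1 (fun t => g t `^ p) (p * g x `^ (p - 1) * dg).
Proof.
move=> Dg g0; have Dp := is_derive1_powR p g0.
exact: (@is_derive1_comp R (@powR R ^~ p) g x _ _ Dp Dg).
Qed.

(** One-sided: [t `^ p] is 1 for [t < 0], so [powR] is not continuous at 0,
and the case [l = 0] needs [g] to approach its limit from above. *)
Lemma cvg_powR_comp {R : realType} (F : set_system R) (FF : Filter F)
    (g : R -> R) (l p : R) :
  0 < p -> g x @[x --> F] --> l -> (\forall x \near F, 0 < g x) -> 0 <= l ->
  g x `^ p @[x --> F] --> l `^ p.
Proof.
move=> p0 gl gpos; rewrite le_eqVlt => /predU1P[l0|l0].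
  rewrite -l0 powR0 ?gt_eqF//.
  apply: (@cvg_comp _ _ _ g (@powR R ^~ p) F 0^'+); last exact: powR_cvg0.
  move=> A; rewrite /at_right /within /= => A0.
  move: gl; rewrite -l0 => /(_ _ A0) /=; rewrite /nbhs /= => gA.
  by apply: filterS2 gpos gA => x gx /(_ gx).
have := is_derive1_powR p l0 => -[dp _].
have /derivable1_diffP/differentiable_continuous cp := dp.
exact: (@cvg_comp _ _ _ g (@powR R ^~ p) F (nbhs l) _ gl cp).
Qed.

(** For [c < x < 1], the factor common to the big -1-Jacobi weights of [x]
and of [- x], with [p = (alpha + 1) / 2] and [q = (beta + 1) / 2]. *)
Definition half_weight {R : realType} (p q c x : R) : R :=
  (1 - x ^+ 2) `^ (p - 1) * (x ^+ 2 - c ^+ 2) `^ (q - 1).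

Lemma sqr_bounds {R : realType} (c x : R) : 0 < c -> x \in `]c, 1[ ->
  [/\ 0 < x, 0 < 1 - x ^+ 2 & 0 < x ^+ 2 - c ^+ 2].
Proof.
move=> c0; rewrite in_itv/= => /andP[cx x1]; split; nra.
Qed.

Lemma is_derive_1Msqr {R : realType} (x : R) :
  is_derive x 1 (fun t => 1 - t ^+ 2) (- (2 * x)).
Proof.
have -> : (fun t : R => 1 - t ^+ 2) = horner (1 - 'X^2).
  by apply/funext => t; rewrite !hornerE.
apply: is_derive_eq.
by rewrite derivB derivC derivXn !hornerE; ring.
Qed.

Lemma is_derive_sqrB {R : realType} (c x : R) :
  is_derive x 1 (fun t => t ^+ 2 - c ^+ 2) (2 * x).
Proof.
have -> : (fun t : R => t ^+ 2 - c ^+ 2) = horner ('X^2 - (c ^+ 2)%:P).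
  by apply/funext => t; rewrite !hornerE.
apply: is_derive_eq.
by rewrite derivB derivC derivXn !hornerE; ring.
Qed.

Lemma is_derive_powR_1Msqr {R : realType} (c p x : R) : 0 < c ->
  x \in `]c, 1[ ->
  is_derive x 1 (fun t => (1 - t ^+ 2) `^ p)
    (p * (1 - x ^+ 2) `^ (p - 1) * - (2 * x)).
Proof.
move=> c0 /(sqr_bounds _ _ c0)[_ px _].
exact: is_derive_powR_comp (is_derive_1Msqr x) px.
Qed.

Lemma is_derive_powR_sqrB {R : realType} (c q x : R) : 0 < c ->
  x \in `]c, 1[ ->
  is_derive x 1 (fun t => (t ^+ 2 - c ^+ 2) `^ q)
    (q * (x ^+ 2 - c ^+ 2) `^ (q - 1) * (2 * x)).
Proof.
move=> c0 /(sqr_bounds _ _ c0)[_ _ qx].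
exact: is_derive_powR_comp (is_derive_sqrB c x) qx.
Qed.

Lemma is_derive_continuous {R : realType} (f : R -> R) (x df : R) :
  is_derive x 1 f df -> {for x, continuous f}.
Proof. by case=> /derivable1_diffP/differentiable_continuous. Qed.

Lemma half_weight_continuous {R : realType} (p q c : R) : 0 < c ->
  {in `]c, 1[, continuous (half_weight p q c)}.
Proof.
move=> c0 x xc1.
have /is_derive_continuous cp := is_derive_powR_1Msqr _ (p - 1) _ c0 xc1.
have /is_derive_continuous cq := is_derive_powR_sqrB _ (q - 1) _ c0 xc1.
exact: (cvgM cp cq).
Qed.

Lemma near_oo_at_right {R : realType} (a b : R) (P : R -> Prop) : a < b ->
  {in `]a, b[, forall x, P x} -> \forall x \near a^'+, P x.
Proof.
by move=> ab HP; near=> x; apply: HP; rewrite in_itv/=; apply/andP.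
Unshelve. all: by end_near. Qed.

Lemma near_oo_at_left {R : realType} (a b : R) (P : R -> Prop) : a < b ->
  {in `]a, b[, forall x, P x} -> \forall x \near b^'-, P x.
Proof.
by move=> ab HP; near=> x; apply: HP; rewrite in_itv/=; apply/andP.
Unshelve. all: by end_near. Qed.

Lemma powR_sqr_cvg {R : realType} (c p q x : R) (F : set_system R) (FF : Filter F) :
  0 < p -> 0 < q -> F `=>` nbhs x ->
  (\forall t \near F, 0 < 1 - t ^+ 2) -> (\forall t \near F, 0 < t ^+ 2 - c ^+ 2) ->
  0 <= 1 - x ^+ 2 -> 0 <= x ^+ 2 - c ^+ 2 ->
  (fun t => (1 - t ^+ 2) `^ p) @ F --> (1 - x ^+ 2) `^ p /\
  (fun t => (t ^+ 2 - c ^+ 2) `^ q) @ F --> (x ^+ 2 - c ^+ 2) `^ q.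
Proof.
move=> p0 q0 Fx F1 F2 x1 x2; split; apply: cvg_powR_comp => //.
- exact: cvg_trans (cvg_app _ Fx) (is_derive_continuous _ _ _ (is_derive_1Msqr x)).
- exact: cvg_trans (cvg_app _ Fx) (is_derive_continuous _ _ _ (is_derive_sqrB c x)).
Qed.

Lemma powR_sqr_cvg_ends {R : realType} (c p q : R) : 0 < c -> c < 1 ->
  0 < p -> 0 < q ->
  [/\ (fun t => (1 - t ^+ 2) `^ p) @ c^'+ --> (1 - c ^+ 2) `^ p,
      (fun t => (1 - t ^+ 2) `^ p) @ 1^'- --> (0 : R),
      (fun t => (t ^+ 2 - c ^+ 2) `^ q) @ c^'+ --> (0 : R)
    & (fun t => (t ^+ 2 - c ^+ 2) `^ q) @ 1^'- --> (1 - c ^+ 2) `^ q].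
Proof.
move=> c0 c1 p0 q0.
have pos1 : {in `]c, 1[, forall t, 0 < 1 - t ^+ 2}.
  by move=> t /(sqr_bounds _ _ c0)[].
have posc : {in `]c, 1[, forall t, 0 < t ^+ 2 - c ^+ 2}.
  by move=> t /(sqr_bounds _ _ c0)[].
have c2 : 0 <= 1 - c ^+ 2 by nra.
have p_neq0 : p != 0 by rewrite gt_eqF.
have q_neq0 : q != 0 by rewrite gt_eqF.
have [|Ac Bc] := @powR_sqr_cvg R c p q c c^'+ _ p0 q0 (cvg_within _)
  (near_oo_at_right _ _ _ c1 pos1) (near_oo_at_right _ _ _ c1 posc) c2.
  by rewrite subrr.
have [||A1 B1] := @powR_sqr_cvg R c p q 1 1^'- _ p0 q0 (cvg_within _)
  (near_oo_at_left _ _ _ c1 pos1) (near_oo_at_left _ _ _ c1 posc).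
- by rewrite expr1n subrr.
- by rewrite expr1n.
move: Bc A1 B1; rewrite expr1n !subrr !powR0// => Bc A1 B1; split => //.
Qed.

(** Writing [1 - c^2 = (1 - x^2) + (x^2 - c^2)] splits the weight into two
terms, each with a single singular factor. Their sum is at most a multiple of
[m(x) = 2 x ((x^2 - c^2)^(q - 1) + (1 - x^2)^(p - 1))], the derivative of an
explicit continuous function. *)
Lemma half_weight_integrable {R : realType} (p q c : R) : 0 < c -> c < 1 ->
  0 < p -> 0 < q ->
  (@lebesgue_measure R).-integrable `[c, 1] (EFin \o half_weight p q c).
Proof.
move=> c0 c1 p0 q0.
pose M x := (x ^+ 2 - c ^+ 2) `^ q / q - (1 - x ^+ 2) `^ p / p.
pose m x := 2 * x * ((x ^+ 2 - c ^+ 2) `^ (q - 1) + (1 - x ^+ 2) `^ (p - 1)).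
have [Ac A1 Bc B1] := powR_sqr_cvg_ends c p q c0 c1 p0 q0.
have p_neq0 : p != 0 by rewrite gt_eqF.
have q_neq0 : q != 0 by rewrite gt_eqF.
have DM x : x \in `]c, 1[ -> is_derive x 1 M (m x).
  move=> xc1.
  have DA := is_derive_powR_1Msqr _ p _ c0 xc1.
  have DB := is_derive_powR_sqrB _ q _ c0 xc1.
  rewrite /M; apply: is_derive_eq.
  by rewrite /GRing.scale /= /m; field; apply/andP.
have im : (@lebesgue_measure R).-integrable `[c, 1] (EFin \o m).
  apply: (@ge0_derive_integrable R m M c 1 c1).
  - move=> x xc1.
    have /is_derive_continuous cp := is_derive_powR_1Msqr _ (p - 1) _ c0 xc1.
    have /is_derive_continuous cq := is_derive_powR_sqrB _ (q - 1) _ c0 xc1.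
    apply: cvgM; last exact: (cvgD cq cp).
    by apply: cvgM; [exact: cvg_cst|exact: cvg_id].
  - move=> x /(sqr_bounds _ _ c0)[x0 _ _].
    by rewrite mulr_ge0 ?addr_ge0 ?powR_ge0// mulr_ge0// ltW.
  - split.
    + by move=> x /DM[].
    + rewrite /M subrr powR0//.
      by apply: cvgB; apply: cvgM; rewrite //; exact: cvg_cst.
    + rewrite /M expr1n subrr powR0//.
      by apply: cvgB; apply: cvgM; rewrite //; exact: cvg_cst.
  - by move=> x /DM D; rewrite derive1E derive_val.
(* The bound v (1 - c^2) <= m / (2 x) and x >= c give v <= k m. *)
pose k := (2 * c * (1 - c ^+ 2))^-1.
have c2 : 0 < 1 - c ^+ 2 by nra.
have k0 : 0 < k by rewrite invr_gt0 !mulr_gt0.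
have ikm : (@lebesgue_measure R).-integrable `[c, 1] (fun x => k%:E * (m x)%:E)%E.
  exact: integrableZl.
apply: (le_integrable _ _ _ ikm) => //.
  apply/measurable_EFinP; apply: continuous_oo_measurable.
  exact: half_weight_continuous.
move=> x /=; rewrite in_itv/= => /andP[cx x1].
have x1' : 0 <= 1 - x ^+ 2 by nra.
have xc' : 0 <= x ^+ 2 - c ^+ 2 by nra.
have x0 : 0 < x by lra.
rewrite lee_fin ger0_norm ?mulr_ge0 ?powR_ge0// ger0_norm; last first.
  by rewrite !mulr_ge0 ?addr_ge0 ?powR_ge0// ltW.
rewrite /half_weight /m.
have Ea := mulr_powRB1 x1' p0; have Eb := mulr_powRB1 xc' q0.
have pow1 s : (1 : R) `^ s = 1 by rewrite powR1.
have Ha : (1 - x ^+ 2) `^ p <= 1.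
  rewrite -[leRHS](pow1 p); apply: ge0_ler_powR; rewrite ?nnegrE ?(ltW p0) ?(ltW q0)//; nra.
have Hb : (x ^+ 2 - c ^+ 2) `^ q <= 1.
  rewrite -[leRHS](pow1 q); apply: ge0_ler_powR; rewrite ?nnegrE ?(ltW p0) ?(ltW q0)//; nra.
have u0 := powR_ge0 (1 - x ^+ 2) (p - 1).
have v0 := powR_ge0 (x ^+ 2 - c ^+ 2) (q - 1).
move: Ea Eb u0 v0.
set u := (1 - x ^+ 2) `^ (p - 1); set v := (x ^+ 2 - c ^+ 2) `^ (q - 1).
move=> Ea Eb u0 v0.
rewrite /k ler_pdivlMl ?mulr_gt0//.
have -> : 2 * c * (1 - c ^+ 2) * (u * v) =
    2 * c * (v * ((1 - x ^+ 2) * u) + u * ((x ^+ 2 - c ^+ 2) * v)) by ring.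
rewrite Ea Eb.
have : v * (1 - x ^+ 2) `^ p + u * (x ^+ 2 - c ^+ 2) `^ q <= v + u.
  by rewrite lerD// ler_piMr.
move=> H; apply: (@le_trans _ _ (2 * c * (v + u))).
  by rewrite ler_wpM2l// mulr_ge0// ltW.
by rewrite ler_wpM2r ?addr_ge0// ler_wpM2l.
Qed.

(** * Moment functionals *)

Lemma poly_mul_integrable {R : realType} (v : R -> R) (a b : R) (h : {poly R}) :
  (@lebesgue_measure R).-integrable `[a, b] (EFin \o v) ->
  (@lebesgue_measure R).-integrable `[a, b] (EFin \o (fun x => h.[x] * v x)).
Proof.
move=> iv; have ch : continuous (horner h) by exact: continuous_horner.
have [|M [Mr hM]] := @compact_bounded R _ (horner h @` `[a, b]).
  apply: continuous_compact; last exact: segment_compact.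
  exact: continuous_subspaceT.
apply: (@integrableMr _ (measurableTypeR R) R lebesgue_measure `[a, b] _
  (horner h) (EFin \o v)) => //.
  apply: measurable_funTS; exact: continuous_measurable_fun.
by exists M; split => // t Mt x abx; apply: hM => //; exists x.
Qed.

Definition moment {R : realType} (v : R -> R) (a b : R) (h : {poly R}) : R :=
  \int[lebesgue_measure]_(x in `[a, b]) (h.[x] * v x).

Lemma momentD {R : realType} (v : R -> R) (a b : R) (h1 h2 : {poly R}) :
  (@lebesgue_measure R).-integrable `[a, b] (EFin \o v) ->
  moment v a b (h1 + h2) = moment v a b h1 + moment v a b h2.
Proof.
move=> iv; rewrite /moment -RintegralD//; try exact: poly_mul_integrable.
by apply: eq_Rintegral => x _; rewrite hornerD mulrDl.
Qed.

Lemma momentZ {R : realType} (v : R -> R) (a b k : R) (h : {poly R}) :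
  (@lebesgue_measure R).-integrable `[a, b] (EFin \o v) ->
  moment v a b (k *: h) = k * moment v a b h.
Proof.
move=> iv; rewrite /moment -RintegralZl//; try exact: poly_mul_integrable.
by apply: eq_Rintegral => x _; rewrite hornerZ mulrA.
Qed.

(** The integrand vanishes almost everywhere, while the set where a nonzero
[h] does not vanish is open and nonempty in [`]a, b[], so of positive
measure. *)
Lemma moment_ge0_eq0 {R : realType} (v : R -> R) (a b : R) (h : {poly R}) :
  a < b -> (@lebesgue_measure R).-integrable `[a, b] (EFin \o v) ->
  {in `[a, b], forall x, 0 <= v x} -> {in `]a, b[, forall x, 0 < v x} ->
  {in `[a, b], forall x, 0 <= h.[x]} ->
  moment v a b h = 0 -> h = 0.
Proof.
move=> ab iv v0 vpos h0 mh.
have ihv := poly_mul_integrable v a b h iv.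
have [N [mN N0 subN]] : ae_eq (@lebesgue_measure R) `[a, b]%classic
    (EFin \o (fun x => h.[x] * v x)) (cst 0%E).
  apply/ae_eq_integral_abs => //; first exact: measurable_int ihv.
  pose f x := h.[x] * v x.
  have -> : (\int[lebesgue_measure]_(x in `[a, b]) `|(EFin \o f) x| =
      \int[lebesgue_measure]_(x in `[a, b]) (EFin \o f) x)%E.
    apply: eq_integral => x; rewrite inE /= => xab.
    by rewrite ger0_norm// mulr_ge0 ?h0 ?v0.
  rewrite -[LHS]fineK; last exact: integrable_fin_num.
  by congr (_%:E).
have ooI : open (`]a, b[%classic : set R) by exact: interval_open.
apply: contrapT => /eqP hn0.
pose E := `]a, b[%classic `&` [set x | h.[x] != 0].
have oE : open E.
  apply: openI => //; have -> : [set x | h.[x] != 0] = horner h @^-1` [set~ 0].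
    by apply/seteqP; split => x /= /eqP.
  apply: open_comp; first by move=> x _; exact: continuous_horner.
  by rewrite openC; exact: closed_eq.
have [x Ex] : E !=set0.
  apply/set0P/negP => /eqP E0; move/eqP: hn0; apply.
  apply: (@poly_eq0_open R h `]a, b[%classic) => //.
    by exists ((a + b) / 2); rewrite /= in_itv/= !midf_lt.
  move=> x xab; apply: contrapT => /eqP hx.
  by have : E x by []; rewrite E0.
have EN : E `<=` N.
  move=> y [yab hy]; apply: subN => /= /(_ (subset_itv_oo_cc yab)) [] /eqP.
  by rewrite mulf_eq0 (negPf hy)/= gt_eqF// vpos.
have /nbhs_ballP[e /= e0 be] : nbhs x E by apply: open_nbhs_nbhs.
have : (lebesgue_measure (ball x e) <= lebesgue_measure N)%E.
  apply: le_measure; rewrite ?inE//; first exact: measurable_ball.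
  exact: subset_trans be EN.
by rewrite [X in (_ <= X)%E]N0 lebesgue_measure_ball ?(ltW e0)// lee_fin
  leNgt mulrn_wgt0.
Qed.

(** * The big -1-Jacobi weight, folded onto the positive half-line *)

Lemma integral_itvN {R : realType} (f : R -> R) (a b : R) :
  measurable_fun [set: R] f ->
  (@lebesgue_measure R).-integrable `[a, b] (fun x => (f (- x))%:E) ->
  (\int[lebesgue_measure]_(x in `[(- b)%R, (- a)%R]) (f x)%:E =
   \int[lebesgue_measure]_(x in `[a, b]) (f (- x)%R)%:E)%E.
Proof.
move=> mf iab.
have <- : (-%R : _ -> measurableTypeR R) @^-1` `[- b, - a]%classic = `[a, b]%classic.
  by rewrite opp_preimage_itvbndbnd !opprK.
have h := @integral_pushforward _ _ (measurableTypeR R) (measurableTypeR R) R -%R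
  _ lebesgue_measure `[- b, - a]%classic (EFin \o f).
rewrite -h//=.
- by apply: eq_measure_integral => //= A mA AS; exact/esym/lebesgue_measureN.
- exact/measurable_EFinP.
- by rewrite opp_preimage_itvbndbnd !opprK.
Qed.

(** The polynomial factor of [h(x) w(x) + h(- x) w(- x)] for [c < x < 1], [w]
being the big -1-Jacobi weight. *)
Definition bigm1_fold {R : realType} (c : R) (h : {poly R}) : {poly R} :=
  h * ('X + 1) * ('X - c%:P) + (h \Po - 'X) * (1 - 'X) * ('X + c%:P).

Lemma horner_bigm1_fold {R : realType} (c : R) (h : {poly R}) (x : R) :
  (bigm1_fold c h).[x] =
  h.[x] * (x + 1) * (x - c) + h.[- x] * (1 - x) * (x + c).
Proof. by rewrite !(hornerD, hornerN, hornerM, hornerC, horner_comp, hornerX). Qed.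

Lemma bigm1_foldD {R : realType} (c : R) (h1 h2 : {poly R}) :
  bigm1_fold c (h1 + h2) = bigm1_fold c h1 + bigm1_fold c h2.
Proof. by rewrite /bigm1_fold comp_polyD; ring. Qed.

Lemma bigm1_foldZ {R : realType} (c k : R) (h : {poly R}) :
  bigm1_fold c (k *: h) = k *: bigm1_fold c h.
Proof. by rewrite /bigm1_fold comp_polyZ -!mul_polyC; ring. Qed.

Definition bigm1_moment {R : realType} (alpha beta c : R) (h : {poly R}) : R :=
  moment (half_weight ((alpha + 1) / 2) ((beta + 1) / 2) c) c 1 (bigm1_fold c h).

Lemma measurable_bigm1_weight {R : realType} (alpha beta c : R) :
  measurable_fun [set: R] (bigm1_weight alpha beta c).
Proof.
have mX : measurable_fun [set: R] (fun x : R => x ^+ 2).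
  by apply: measurable_funX; exact: measurable_id.
have mpow (g : R -> R) s : measurable_fun [set: R] g ->
    measurable_fun [set: R] (fun x => g x `^ s).
  by move=> mg; exact: (measurableT_comp (@measurable_powR R s) mg).
rewrite /bigm1_weight; apply: measurable_funM; last first.
  by apply: mpow; apply: measurable_funB.
apply: measurable_funM; last by apply: mpow; apply: measurable_funB.
apply: measurable_funM; last by apply: measurable_funB.
apply: measurable_funM; last by apply: measurable_funD.
have -> : (fun x : R => `|x| / x) =
    (fun x => \1_`]0, +oo[%classic x - \1_`]-oo, 0[%classic x).
  apply/funext => x; rewrite !indicE !mem_setE !in_itv/= andbT.
  have [x0|x0|->] := ltgtP x 0; last by rewrite normr0 mul0r subr0.
    by rewrite sub0r ltr0_norm// mulNr divff// lt_eqF.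
  by rewrite subr0 gtr0_norm// divff// gt_eqF.
by apply: measurable_funB; exact: measurable_indic.
Qed.

Lemma bigm1_weight_pos {R : realType} (alpha beta c x : R) : 0 < x ->
  bigm1_weight alpha beta c x =
  (x + 1) * (x - c) * half_weight ((alpha + 1) / 2) ((beta + 1) / 2) c x.
Proof.
move=> x0; rewrite /bigm1_weight /half_weight gtr0_norm// divff ?gt_eqF//.
have h (t : R) : (t - 1) / 2 = (t + 1) / 2 - 1 by field.
by rewrite !h; ring.
Qed.

Lemma bigm1_weight_neg {R : realType} (alpha beta c x : R) : 0 < x ->
  bigm1_weight alpha beta c (- x) =
  (1 - x) * (x + c) * half_weight ((alpha + 1) / 2) ((beta + 1) / 2) c x.
Proof.
move=> x0; rewrite /bigm1_weight /half_weight normrN gtr0_norm// invrN mulrN.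
rewrite divff ?gt_eqF// !sqrrN.
have h (t : R) : (t - 1) / 2 = (t + 1) / 2 - 1 by field.
by rewrite !h; ring.
Qed.

Lemma integral_bigm1_weight {R : realType} (alpha beta c : R) (h : {poly R}) :
  0 < c < 1 -> -1 < alpha -> -1 < beta ->
  (\int[lebesgue_measure]_(x in bigm1_support c)
     (h.[x] * bigm1_weight alpha beta c x)%:E = (bigm1_moment alpha beta c h)%:E)%E.
Proof.
move=> /andP[c0 c1] a1 b1.
set p := (alpha + 1) / 2; set q := (beta + 1) / 2.
have p0 : 0 < p by rewrite /p; lra.
have q0 : 0 < q by rewrite /q; lra.
have iv := half_weight_integrable p q c c0 c1 p0 q0.
pose f x := h.[x] * bigm1_weight alpha beta c x.
have mf : measurable_fun [set: R] f.
  apply: measurable_funM; last exact: measurable_bigm1_weight.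
  by apply: continuous_measurable_fun; exact: continuous_horner.
pose g1 := h * ('X + 1) * ('X - c%:P).
pose g2 := (h \Po - 'X) * (1 - 'X) * ('X + c%:P).
have ig1 := poly_mul_integrable _ _ _ g1 iv.
have ig2 := poly_mul_integrable _ _ _ g2 iv.
have xpos x : x \in `[c, 1] -> 0 < x.
  by rewrite in_itv/= => /andP[cx _]; exact: lt_le_trans cx.
have E1 x : x \in `[c, 1] -> f x = g1.[x] * half_weight p q c x.
  move=> /xpos x0; rewrite /f bigm1_weight_pos// -/p -/q /g1.
  by rewrite !(hornerD, hornerN, hornerM, hornerC, hornerX); ring.
have E2 x : x \in `[c, 1] -> f (- x) = g2.[x] * half_weight p q c x.
  move=> /xpos x0; rewrite /f bigm1_weight_neg// -/p -/q /g2.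
  by rewrite !(hornerD, hornerN, hornerM, hornerC, horner_comp, hornerX); ring.
have if2 : (@lebesgue_measure R).-integrable `[c, 1] (fun x => (f (- x))%:E).
  apply: eq_integrable ig2 => //= x; rewrite inE /= => xc1.
  by rewrite E2.
rewrite /bigm1_support integral_setU//; last first.
- apply/disj_set2P; rewrite -subset0 => x /=; rewrite !in_itv/=.
  by move=> [/andP[_ xc] /andP[cx _]]; lra.
- apply: measurable_funTS; exact/measurable_EFinP.
have := @integral_itvN R f c 1 mf if2; rewrite /f => ->.
rewrite -/f.
rewrite [X in (X + _)%E](_ : _ =
  (\int[lebesgue_measure]_(x in `[c, 1]) (g2.[x] * half_weight p q c x))%:E).
rewrite [X in (_ + X)%E](_ : _ =
  (\int[lebesgue_measure]_(x in `[c, 1]) (g1.[x] * half_weight p q c x))%:E).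
- rewrite /bigm1_moment /bigm1_fold -/p -/q addrC -EFinD -!/(moment _ _ _ _).
  by rewrite -momentD.
- rewrite /Rintegral fineK; last exact: integrable_fin_num ig1.
  by apply: eq_integral => x; rewrite inE /= => xc1; congr (_%:E); exact: E1.
- rewrite /Rintegral fineK; last exact: integrable_fin_num ig2.
  by apply: eq_integral => x; rewrite inE /= => xc1; congr (_%:E); exact: E2.
Qed.

(** * The big -1-Jacobi operator: degree and symmetry *)

Definition bigm1_op {R : realType} (alpha beta c : R) :=
  dunkl_FG (bigm1_F alpha beta c) (bigm1_G c).

(** Away from 0, where the coefficients of the operator below have a pole. *)
Definition acts_as {R : realType} {N : nat} (L : dunkl_op R N) (p q : {poly R}) :=
  forall x, x != 0 -> dunkl_act L (horner p) x = q.[x].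

(** The poles at 0 cancel. For [n = 1] the two residues [- 2 c] and [2 c] are
opposite; for [n >= 2] the image is [x^(n - 2)] times a quadratic. *)
Lemma bigm1_op_monomial {R : realType} (alpha beta c : R) (n : nat) :
  exists q : {poly R},
    (size q <= n.+1)%N /\ acts_as (bigm1_op alpha beta c) 'X^n q.
Proof.
case: n => [|[|n]].
- exists 0; rewrite size_poly0; split => // x x0.
  rewrite dunkl_act_FG_horner expr0 derivC !hornerC.
  by rewrite subrr !mulr0 subr0.
- exists (Poly [:: 2 * (beta - alpha * c) - 2 * (c - 1); - 2 * (alpha + beta + 2)]).
  split => [|x x0]; first exact: size_Poly.
  rewrite dunkl_act_FG_horner expr1 derivX horner_Poly !(hornerX, hornerC) /=.
  by rewrite /bigm1_F /bigm1_G; field.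
- (* s is the parity sign: (- x) ^ (n + 2) = s x ^ (n + 2). *)
  pose m : R := n.+2%:R; pose s : R := (-1) ^+ n.
  pose Q := Poly [:: - (1 - s) * c - 2 * s * m * c;
      (1 - s) * (beta - alpha * c) + 2 * s * m * (c - 1);
      - (1 - s) * (alpha + beta + 1) + 2 * s * m].
  have sQ : (size Q <= 3)%N by exact: size_Poly.
  exists (Q * 'X^n); split => [|x x0].
    apply: (leq_trans (size_polyMleq _ _)); rewrite size_polyXn addnS /=.
    by rewrite -[n.+3]/(3 + n)%N leq_add2r.
  rewrite (hornerM Q) /Q horner_Poly dunkl_act_FG_horner derivXn.
  rewrite !(hornerMn, hornerXn) /=.
  rewrite !(exprNn x).
  rewrite -mulr_natr !exprS -/s /bigm1_F /bigm1_G -/m.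
  by field.
Qed.

Lemma bigm1_op_poly {R : realType} (alpha beta c : R) (p : {poly R}) :
  exists q : {poly R},
    (size q <= size p)%N /\ acts_as (bigm1_op alpha beta c) p q.
Proof.
have [n] := ubnP (size p); elim: n p => // n IH p; rewrite ltnS => sp.
have [->|p0] := eqVneq p 0.
  exists 0; rewrite size_poly0; split => // x x0.
  by rewrite dunkl_act_FG_horner deriv0 !horner0; ring.
have [m mE] : exists m, size p = m.+1.
  by exists (size p).-1; rewrite prednK// size_poly_gt0.
pose r := p - p`_m *: 'X^m.
have sr : (size r <= m)%N.
  apply/leq_sizeP => j; rewrite leq_eqVlt coefB coefZ coefXn => /predU1P[<-|mj].
    by rewrite eqxx mulr1 subrr.
  by rewrite gtn_eqF// mulr0 subr0 nth_default// mE.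
have [|q1 [sq1 q1E]] := IH r; first by rewrite (leq_ltn_trans sr)// -mE.
have [q2 [sq2 q2E]] := bigm1_op_monomial alpha beta c m.
exists (q1 + p`_m *: q2); split => [|x x0].
  rewrite mE (leq_trans (size_polyD _ _))// geq_max.
  by rewrite (leq_trans sq1 (leqW sr)) (leq_trans (size_scale_leq _ _)).
rewrite hornerD hornerZ -q1E// -q2E// !dunkl_act_FG_horner /r.
by rewrite derivB derivZ !hornerE; ring.
Qed.

(** With [N(x) = 2 (f(x) g(- x) - f(- x) g(x))], the folded integrand of
[<Lf, g> - <f, Lg>] is the derivative of [H = N A B / x], which vanishes at
[c] and at [1] because the exponents [p] and [q] are positive. *)
Lemma bigm1_op_symmetric {R : realType} (alpha beta c : R)
    (f g Lf Lg : {poly R}) : 0 < c < 1 -> -1 < alpha -> -1 < beta ->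
  acts_as (bigm1_op alpha beta c) f Lf -> acts_as (bigm1_op alpha beta c) g Lg ->
  bigm1_moment alpha beta c (Lf * g - f * Lg) = 0.
Proof.
move=> /andP[c0 c1] a1 b1 fE gE; rewrite /bigm1_moment.
set p := (alpha + 1) / 2; set q := (beta + 1) / 2.
have p0 : 0 < p by rewrite /p; lra.
have q0 : 0 < q by rewrite /q; lra.
have p_neq0 : p != 0 by rewrite gt_eqF.
have q_neq0 : q != 0 by rewrite gt_eqF.
have iv := half_weight_integrable p q c c0 c1 p0 q0.
pose N := 2 *: (f * (g \Po - 'X) - (f \Po - 'X) * g).
pose A x := (1 - x ^+ 2) `^ p.
pose B x := (x ^+ 2 - c ^+ 2) `^ q.
pose H x := N.[x] * (A x * B x / x).
have DH x : x \in `]c, 1[ -> is_derive x 1 H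
    ((bigm1_fold c (Lf * g - f * Lg)).[x] * half_weight p q c x).
  move=> xc1; have [x0 x1 xc] := sqr_bounds _ _ c0 xc1.
  have xn0 : x != 0 by rewrite gt_eqF.
  have DA : is_derive x 1 A _ := is_derive_powR_1Msqr _ p _ c0 xc1.
  have DB : is_derive x 1 B _ := is_derive_powR_sqrB _ q _ c0 xc1.
  have DV := is_deriveV xn0 (is_derive_id x 1).
  have D := is_deriveM (is_derive_poly N x) (is_deriveM (is_deriveM DA DB) DV).
  apply: (is_derive_eq D); rewrite /GRing.scale /= /half_weight /A /B !fctE.
  rewrite -(mulr_powRB1 (ltW x1) p0) -(mulr_powRB1 (ltW xc) q0).
  rewrite horner_bigm1_fold !(hornerD, hornerN, hornerM).
  rewrite -fE// -gE// -fE ?oppr_eq0// -gE ?oppr_eq0//.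
  rewrite !dunkl_act_FG_horner !opprK /N derivZ derivB !derivM !deriv_comp.
  rewrite derivN derivX !(hornerD, hornerN, hornerM, hornerZ, horner_comp,
    hornerX, hornerC).
  rewrite /bigm1_F /bigm1_G /p /q.
  by field.
have [Ac A1 Bc B1] := powR_sqr_cvg_ends c p q c0 c1 p0 q0.
have cN y (F : set_system R) : Filter F -> F `=>` nbhs y ->
    N.[x] @[x --> F] --> N.[y].
  by move=> FF Fy; apply: cvg_trans (cvg_app _ Fy) _; exact: continuous_horner.
have cV y (F : set_system R) : y != 0 -> Filter F -> F `=>` nbhs y ->
    x^-1 @[x --> F] --> y^-1.
  by move=> y0 FF Fy; apply: cvgV => //.
have HLR : derivable_oo_LRcontinuous H c 1.
  split.
  - by move=> x /DH[].
  - rewrite /H /A /B subrr powR0//.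
    apply: cvgM; first by apply: cN; exact: cvg_within.
    by apply: cvgM; [exact: cvgM|apply: cV; [rewrite gt_eqF|exact: cvg_within]].
  - rewrite /H /A /B expr1n subrr powR0//.
    apply: cvgM; first by apply: cN; exact: cvg_within.
    by apply: cvgM; [exact: cvgM|apply: cV; [rewrite oner_eq0|exact: cvg_within]].
rewrite /moment (@integrable_derive_FTC2 R _ H)//.
- by rewrite /H /A /B expr1n !subrr !powR0// !(mul0r, mulr0) subrr.
- move=> x xc1; apply: cvgM; first exact: continuous_horner.
  exact: half_weight_continuous.
- exact: poly_mul_integrable.
- by move=> x /DH D; rewrite derive1E derive_val.
Qed.

(** * Orthogonal polynomials of a symmetric operator *)

(** [P n] is orthogonal to all polynomials of degree less than [n], these
being combinations of the [P m] with [m < n]. So is [L (P n)], by symmetry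
and because [L] does not raise degrees. Their combination that cancels the
coefficient of degree [n] is then orthogonal to itself. *)
Lemma orthogonal_eigenpoly {R : realType} (I : {poly R} -> R)
    (L : {poly R} -> {poly R}) (P : nat -> {poly R}) :
  (forall f g, I (f + g) = I f + I g) -> (forall k f, I (k *: f) = k * I f) ->
  (forall f, I (f * f) = 0 -> f = 0) ->
  (forall f, (size (L f) <= size f)%N) ->
  (forall f g, I (L f * g) = I (f * L g)) ->
  (forall n, P n \is monic /\ size (P n) = n.+1) ->
  (forall n m, n != m -> I (P n * P m) = 0) ->
  forall n, exists lambda : R, L (P n) = lambda *: P n.
Proof.
move=> ID IZ Idef sL Isym mP oP n.
have I0 : I 0 = 0 by rewrite -(scale0r 0) IZ mul0r.
have Pnn k : (P k)`_k = 1.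
  by have [/monicP mk sk] := mP k; rewrite -mk lead_coefE sk.
have orth k (g : {poly R}) : (size g <= k)%N -> (k <= n)%N -> I (P n * g) = 0.
  elim: k g => [|k IH] g sg kn.
    by move: sg; rewrite leqn0 size_poly_eq0 => /eqP ->; rewrite mulr0.
  have [_ sk] := mP k.
  pose r := g - g`_k *: P k.
  have sr : (size r <= k)%N.
    apply/leq_sizeP => j; rewrite leq_eqVlt coefB coefZ => /predU1P[<-|kj].
      by rewrite Pnn mulr1 subrr.
    have -> : g`_j = 0 by rewrite nth_default// (leq_trans sg).
    have -> : (P k)`_j = 0 by rewrite nth_default// sk.
    by rewrite mulr0 subr0.
  have -> : P n * g = P n * r + g`_k *: (P n * P k).
    by rewrite /r mulrBr -scalerAr subrK.
  by rewrite ID IZ (IH r sr (ltnW kn)) (oP n k) ?mulr0 ?addr0// gtn_eqF.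
have [_ sn] := mP n.
exists (L (P n))`_n.
pose r := L (P n) - (L (P n))`_n *: P n.
have sr : (size r <= n)%N.
  apply/leq_sizeP => j; rewrite leq_eqVlt coefB coefZ => /predU1P[<-|nj].
    by rewrite Pnn mulr1 subrr.
  have -> : (L (P n))`_j = 0.
    by rewrite nth_default// (leq_trans (sL _))// sn.
  have -> : (P n)`_j = 0 by rewrite nth_default// sn.
  by rewrite mulr0 subr0.
have r0 : r = 0.
  apply: Idef; have {1}-> : r * r = L (P n) * r + (- (L (P n))`_n) *: (P n * r).
    by rewrite {1}/r mulrBl scaleNr -scalerAl.
  rewrite ID IZ Isym (orth n r sr (leqnn n)).
  by rewrite (orth n (L r) (leq_trans (sL r) sr) (leqnn n)) mulr0 addr0.
by apply/eqP; rewrite -subr_eq0 -/r r0.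
Qed.

(** Folding [f^2] gives a sum of two nonnegative terms on [`[c, 1]], the
first of which is [f(x)^2] times a positive factor inside. *)
Lemma bigm1_moment_definite {R : realType} (alpha beta c : R) (f : {poly R}) :
  0 < c < 1 -> -1 < alpha -> -1 < beta ->
  bigm1_moment alpha beta c (f * f) = 0 -> f = 0.
Proof.
move=> /andP[c0 c1] a1 b1; rewrite /bigm1_moment.
set p := (alpha + 1) / 2; set q := (beta + 1) / 2.
have p0 : 0 < p by rewrite /p; lra.
have q0 : 0 < q by rewrite /q; lra.
have iv := half_weight_integrable p q c c0 c1 p0 q0.
have foldE (x : R) : (bigm1_fold c (f * f)).[x] =
    f.[x] ^+ 2 * ((x + 1) * (x - c)) + f.[- x] ^+ 2 * ((1 - x) * (x + c)).
  by rewrite horner_bigm1_fold !hornerM; ring.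
move=> /moment_ge0_eq0 H.
have {}H : bigm1_fold c (f * f) = 0.
  apply: H => // x.
  - by move=> _; rewrite mulr_ge0 ?powR_ge0.
  - by move=> /(sqr_bounds _ _ c0)[x0 x1 xc]; rewrite mulr_gt0 ?powR_gt0.
  - rewrite in_itv/= => /andP[cx x1]; rewrite foldE.
    by apply: addr_ge0; apply: mulr_ge0; rewrite ?sqr_ge0//; apply: mulr_ge0; lra.
have ooI : open (`]c, 1[%classic : set R) by exact: interval_open.
apply: (@poly_eq0_open R f `]c, 1[%classic) => //.
  by exists ((c + 1) / 2); rewrite /= in_itv/= !midf_lt.
move=> x; rewrite /= in_itv/= => /andP[cx x1].
have := foldE x; rewrite H horner0 => /esym/eqP.
rewrite paddr_eq0; last 2 first.
- by apply: mulr_ge0; rewrite ?sqr_ge0//; apply: mulr_ge0; lra.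
- by apply: mulr_ge0; rewrite ?sqr_ge0//; apply: mulr_ge0; lra.
move=> /andP[+ _]; rewrite mulf_eq0 sqrf_eq0 => /orP[/eqP//|].
by rewrite mulf_eq0 => /orP[] /eqP; lra.
Qed.

Lemma bigm1_jacobi_eigen {R : realType} (alpha beta c : R) (P : nat -> {poly R}) :
  0 < c < 1 -> -1 < alpha -> -1 < beta ->
  bigm1_jacobi alpha beta c P ->
  forall n, exists lambda : R,
    dunkl_eigenpoly (dunkl_FG (bigm1_F alpha beta c) (bigm1_G c)) lambda (P n).
Proof.
move=> c01 a1 b1 [mP oP] n.
have [L LP] := choice (bigm1_op_poly alpha beta c).
have [c0 c1] := andP c01.
have iv : (@lebesgue_measure R).-integrable `[c, 1]
    (EFin \o half_weight ((alpha + 1) / 2) ((beta + 1) / 2) c).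
  by apply: half_weight_integrable => //; lra.
have MD f g : bigm1_moment alpha beta c (f + g) =
    bigm1_moment alpha beta c f + bigm1_moment alpha beta c g.
  by rewrite /bigm1_moment bigm1_foldD momentD.
have MZ k f : bigm1_moment alpha beta c (k *: f) = k * bigm1_moment alpha beta c f.
  by rewrite /bigm1_moment bigm1_foldZ momentZ.
have [f|f|f g|i j ij|lambda Llam] := orthogonal_eigenpoly
  (bigm1_moment alpha beta c) L P MD MZ _ _ _ mP _ n.
- exact: bigm1_moment_definite.
- exact: (LP f).1.
- have := bigm1_op_symmetric alpha beta c f g (L f) (L g) c01 a1 b1 (LP f).2 (LP g).2.
  rewrite -(scaleN1r (f * L g)) MD MZ mulN1r => /eqP; rewrite subr_eq0.
  by move/eqP.
- apply: EFin_inj; rewrite -integral_bigm1_weight// -[RHS](oP i j ij).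
  by apply: eq_integral => x _; rewrite hornerM.
exists lambda => x x0.
by rewrite (LP (P n)).2// Llam hornerZ.
Qed.

(** * The characterization *)

Theorem theorem2 (R : realType) :
  (forall (F0 F1 G0 G1 : R -> R) (lambda : nat -> R),
     (forall n, exists P : {poly R},
        [/\ P \is monic, size P = n.+1
          & dunkl_eigenpoly (dunkl1 F0 F1 G0 G1) (lambda n) P]) ->
     lambda 0%N = 0 ->
     (forall n, (1 <= n)%N -> lambda n != 0) ->
     (forall n m, n != m -> lambda n != lambda m) ->
     symmetrizable (dunkl1 F0 F1 G0 G1) ->
     (forall x, x != 0 -> G0 x = 0 /\ F1 x = - F0 x) /\
     dunkl_eq_on [set x | x != 0] (dunkl1 F0 F1 G0 G1) (dunkl_FG F0 G1) /\
     (forall g1 d c' : R,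
        g1 != 0 -> d != 0 -> 0 < c' / d < 1 ->
        (forall x, x != 0 -> G1 x = g1 * (x - d) * (x + c') / x) ->
        exists a kappa alpha beta : R,
          [/\ a != 0, kappa != 0 &
              dunkl_eq_on [set y | y != 0]
                (dunkl_rescale kappa (dunkl_mul (fun=> a) (dunkl1 F0 F1 G0 G1)))
                (dunkl_FG (bigm1_F alpha beta (c' / d)) (bigm1_G (c' / d)))]))
  /\
  (forall (alpha beta c : R) (P : nat -> {poly R}),
     0 < c < 1 -> -1 < alpha -> -1 < beta ->
     bigm1_jacobi alpha beta c P ->
     forall n, exists lambda : R,
       dunkl_eigenpoly (dunkl_FG (bigm1_F alpha beta c) (bigm1_G c)) lambda (P n)).
Proof.
split=> [F0 F1 G0 G1 lambda eig l0 _ _ sym|]; last first.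
  by move=> alpha beta c P c01 a1 b1 jP; exact: bigm1_jacobi_eigen.
have form := dunkl1_symmetrizable_form F0 F1 G0 G1 lambda eig l0 sym.
split=> //; split=> [x x0 k|g1 d c' g0 d0 c01 GE].
  by have [G0x F1x] := form x x0; case: k => -[|[|//]] lk; rewrite /= ?G0x ?F1x.
have [P [/monicP mP sP eP]] := eig 1%N.
have P1 : P`_1 = 1 by rewrite -mP lead_coefE sP.
have PE : P = 'X + (P`_0)%:P.
  apply/polyP => -[|[|j]]; rewrite coefD coefX coefC/= ?add0r ?addr0//.
  by rewrite nth_default// sP.
have FE x : x != 0 -> F0 x * (2 * x) - G1 x = lambda 1%N * (x + P`_0).
  have PxE y : P.[y] = y + P`_0 by rewrite {1}PE hornerD hornerX hornerC.
  have dPE y : P^`().[y] = 1 by rewrite PE derivD derivX derivC !hornerE.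
  move=> x0; have [G0x F1x] := form x x0.
  by rewrite -PxE -(eP x x0) dunkl_act1_horner G0x F1x !PxE !dPE; ring.
have [alpha [beta E]] := dunkl_FG_generic F0 G1 _ _ g1 d c' g0 d0 c01 GE FE.
exists (2 / g1), d, alpha, beta; split => //.
  by rewrite mulf_neq0 ?invr_neq0 ?pnatr_eq0.
move=> y /= y0 k; have dy0 : d * y != 0 by rewrite mulf_neq0.
have [G0y F1y] := form (d * y) dy0; have [Fy Gy] := E y y0.
case: k => -[|[|//]] lk; rewrite /= ?G0y ?F1y ?expr0 ?expr1 ?divr1.
  by rewrite mulrN Fy.
by rewrite mulr0 mul0r Gy.
Qed.
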